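(* Let $n\ge 1$ and $N\ge 1$ be integers, let $L>0$, $\Delta\ge 0$ and $f^\star$ be real numbers, and let $t_k\in\left(0,\tfrac{1}{L}\right]$ for all $k\in\{1,\ldots,N\}$. Then the value $$\left(\frac{4\Delta}{\sum_{k=1}^N \min\left(-L^2t_k^3+4t_k,\,-Lt_k^2+4t_k\right)+\tfrac{2}{L}}\right)^{\tfrac{1}{2}}$$ is the optimal value of the worst-case problem $$\begin{aligned}\max\ & \min_{1\leq k\leq N+1} \left\|\nabla f(x^k)\right\|\\ \text{s.t. } & f(x^1)-f^\star\leq \Delta,\\ & x^{k+1}=x^k-t_k\nabla f(x^k),\quad k\in\{1,\ldots,N\},\\ & f(x)\geq f^\star\quad \forall x\in\mathbb{R}^n,\\ & f\in C^{1,1}_L(\mathbb{R}^n),\quad x^1\in\mathbb{R}^n,\end{aligned}$$ in which the decision variables are the function $f$ and the starting point $x^1$.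
   Context: $\|\cdot\|$ denotes the Euclidean norm. $C^{1,1}_L(\mathbb{R}^n)$ denotes the set of differentiable functions $f:\mathbb{R}^n\to\mathbb{R}$ with $L$-Lipschitz gradient, i.e. $\|\nabla f(x)-\nabla f(y)\|\le L\|x-y\|$ for all $x,y\in\mathbb{R}^n$ (no convexity is assumed). The numbers $N$, $L$, $\Delta$, $f^\star$ and the step lengths $t_1,\ldots,t_N$ are fixed data of the optimization problem. *)

(* Defs.v *)
From HB Require Import structures.
From mathcomp Require Import all_boot all_order all_algebra.
From mathcomp Require Import all_classical all_reals all_analysis.

Set Implicit Arguments.
Unset Strict Implicit.
Unset Printing Implicit Defensive.

Import Order.TTheory GRing.Theory Num.Theory.
Import numFieldNormedType.Exports.

Local Open Scope classical_set_scope.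
Local Open Scope ring_scope.

(* The library norm `|x| on 'rV[R]_n is the sup norm, hence a separate Euclidean
   norm.  Both induce the same topology, so the library's [differentiable] on
   'rV[R]_n is the usual Frechet differentiability. *)
Definition enorm (R : realType) (n : nat) (x : 'rV[R]_n) : R :=
  Num.sqrt (\sum_(i < n) x ord0 i ^+ 2).

Definition gradient (R : realType) (n : nat) (f : 'rV[R]_n -> R)
    (x : 'rV[R]_n) : 'rV[R]_n :=
  \row_(i < n) 'D_(delta_mx ord0 i) f x.

Definition C11 (R : realType) (n : nat) (L : R) : set ('rV[R]_n -> R) :=
  [set f | (forall x, differentiable f x) /\
           (forall x y, enorm (gradient f x - gradient f y)
                          <= L * enorm (x - y))].

(* Only x 1, ..., x N.+1 are meaningful; x 1 is the starting point and
   determines the others, and the remaining values of x are irrelevant. *)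
Definition feasible (R : realType) (n N : nat) (L Delta fstar : R)
    (t : nat -> R) (f : 'rV[R]_n -> R) (x : nat -> 'rV[R]_n) : Prop :=
  [/\ f (x 1%N) - fstar <= Delta,
      forall k, (1 <= k <= N)%N -> x k.+1 = x k - t k *: gradient f (x k),
      forall y, fstar <= f y
    & C11 L f].

(* The minimum over 1 <= k <= N.+1; the default value of the big operator is the
   term k = 1. *)
Definition min_grad_norm (R : realType) (n N : nat) (f : 'rV[R]_n -> R)
    (x : nat -> 'rV[R]_n) : R :=
  \big[Num.min/enorm (gradient f (x 1%N))]_(1 <= k < N.+2)
     enorm (gradient f (x k)).

Definition objective_values (R : realType) (n N : nat) (L Delta fstar : R)
    (t : nat -> R) : set R :=
  [set v | exists (f : 'rV[R]_n -> R) (x : nat -> 'rV[R]_n),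
     feasible N L Delta fstar t f x /\ v = min_grad_norm N f x].

Definition is_maximum (R : realType) (A : set R) (v : R) : Prop :=
  A v /\ ubound A v.

(* Main.v *)
(* Upper bound: at each step, play the quadratic upper model of f at x^k against
   the quadratic lower model at x^(k+1); as L t_k <= 1 this gives
   4 (f(x^k) - f(x^(k+1))) >= (3 t_k - L t_k^2) |g_k|^2 + t_k |g_(k+1)|^2, and the
   sum telescopes, the last term being |g_(N+1)|^2 <= 2 L (f(x^(N+1)) - fstar).
   For L t_k <= 1 the minimum in the formula is its second argument.
   Sharpness: f depends on one coordinate only, and its slope is the smallest
   nonnegative L-Lipschitz function equal to the claimed value U at all the
   iterates x^(k+1) = x^k - t_k U. *)
Require Import Defs.
From mathcomp Require Import all_boot all_order all_algebra.
From mathcomp Require Import all_classical all_reals all_analysis.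
From mathcomp Require Import ring lra.

Import Order.TTheory GRing.Theory Num.Theory.
Import numFieldNormedType.Exports.

Local Open Scope ring_scope.

(** * One-variable growth estimate *)

(** The quadratic minus [phi] has a nonnegative derivative, so it is nondecreasing. This stands in
    for integrating a slope bound, both in [descent] and in the estimates of the worst-case
    profile. *)
Lemma increment_le_quadratic {R : realType} (phi dphi : R -> R) (a b c d : R) :
  a <= b -> (forall s : R, is_derive s (1 : R) phi (dphi s)) ->
  (forall s, a < s < b -> dphi s <= c + d * (s - a)) ->
  phi b - phi a <= c * (b - a) + d / 2 * (b - a) ^+ 2.
Proof.
move=> leab dphiE dphi_le.
pose q (s : R) : R := c * (s - a) + d / 2 * (s - a) ^+ 2 - phi s.
have dq (s : R) : is_derive s (1 : R) q (c + d * (s - a) - dphi s).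
  have := dphiE s => hphi.
  apply: is_derive_eq.
  rewrite /= /GRing.scale /=; lra.
suff : q a <= q b by rewrite /q subrr expr0n /=; lra.
apply: (@ger0_derive1_le_cc _ q a b) => //.
- by move=> s; rewrite in_itv /= => sab; rewrite derive1E derive_val subr_ge0 dphi_le.
- apply: derivable_within_continuous => s _; exact: ex_derive.
- by rewrite in_itv /= lexx.
- by rewrite in_itv /= leab lexx.
Qed.

(** * Euclidean inner product and directional derivatives *)

Definition dotv {R : realType} {n : nat} (u v : 'rV[R]_n) : R :=
  \sum_(i < n) u ord0 i * v ord0 i.

Lemma enorm_ge0 {R : realType} {n : nat} (x : 'rV[R]_n) : 0 <= enorm x.
Proof. exact: sqrtr_ge0. Qed.

Lemma sqr_enorm {R : realType} {n : nat} (x : 'rV[R]_n) :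
  enorm x ^+ 2 = \sum_(i < n) x ord0 i ^+ 2.
Proof. by rewrite sqr_sqrtr // sumr_ge0 // => i _; rewrite sqr_ge0. Qed.

Lemma enormZ {R : realType} {n : nat} (a : R) (x : 'rV[R]_n) :
  enorm (a *: x) = `|a| * enorm x.
Proof.
rewrite /enorm -sqrtr_sqr -sqrtrM ?sqr_ge0 // mulr_sumr.
by congr Num.sqrt; apply: eq_bigr => i _; rewrite mxE exprMn.
Qed.

(** Expanding [|u - c v|^2 >= 0] gives [2 c <u, v> <= |u|^2 + c^2 |v|^2], which suffices here in
    place of Cauchy-Schwarz. *)
Lemma dotv_le {R : realType} {n : nat} (u v : 'rV[R]_n) (c : R) :
  0 < c -> enorm u <= c * enorm v -> dotv u v <= c * enorm v ^+ 2.
Proof.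
move=> c0 uv.
have : enorm u ^+ 2 <= c ^+ 2 * enorm v ^+ 2.
  by rewrite -exprMn lerXn2r // nnegrE ?mulr_ge0 ?enorm_ge0 // ltW.
have : 0 <= \sum_(i < n) (u ord0 i - c * v ord0 i) ^+ 2.
  by rewrite sumr_ge0 // => i _; rewrite sqr_ge0.
have -> : \sum_(i < n) (u ord0 i - c * v ord0 i) ^+ 2 =
    enorm u ^+ 2 - 2 * c * dotv u v + c ^+ 2 * enorm v ^+ 2.
  rewrite !sqr_enorm /dotv !mulr_sumr -sumrB -big_split /=.
  by apply: eq_bigr => i _; ring.
move=> h1 h2; rewrite -(ler_pM2l c0); lra.
Qed.

Lemma dotv_gradient {R : realType} {n : nat} (f : 'rV[R]_n -> R)
    (x d : 'rV[R]_n) :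
  differentiable f x -> dotv (gradient f x) d = 'D_d f x.
Proof.
move=> df; rewrite deriveE // [in RHS](row_sum_delta d) linear_sum.
by apply: eq_bigr => i _; rewrite mxE deriveE // linearZ mulrC.
Qed.

Lemma is_derive_line {R : realType} {n : nat} (f : 'rV[R]_n -> R)
    (x d : 'rV[R]_n) (s : R) :
  (forall y, differentiable f y) ->
  is_derive s (1 : R) (fun s : R => f (s *: d + x)) (dotv (gradient f (s *: d + x)) d).
Proof.
move=> df.
have dl : is_diff s (fun s : R => s *: d + x) (fun h : R => h *: d).
  by apply: is_diff_eq; rewrite addr0.
have dfl : differentiable (f \o (fun s : R => s *: d + x)) s.
  exact: differentiable_comp.
apply: DeriveDef; first exact/derivable1_diffP.
rewrite deriveE // diff_comp // diff_val /= scale1r.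
by rewrite dotv_gradient // deriveE.
Qed.

Lemma dotvDl {R : realType} {n : nat} (u v w : 'rV[R]_n) :
  dotv (u + v) w = dotv u w + dotv v w.
Proof.
by rewrite /dotv -big_split; apply: eq_bigr => i _; rewrite mxE mulrDl.
Qed.

Lemma dotvNl {R : realType} {n : nat} (u v : 'rV[R]_n) :
  dotv (- u) v = - dotv u v.
Proof.
by rewrite /dotv -sumrN; apply: eq_bigr => i _; rewrite mxE mulNr.
Qed.

Lemma enormN {R : realType} {n : nat} (u : 'rV[R]_n) : enorm (- u) = enorm u.
Proof. by rewrite -scaleN1r enormZ normrN1 mul1r. Qed.

(** * Quadratic models of functions with Lipschitz gradient *)

(** On the segment from [x] to [d + x], the slope at parameter [s] differs from the initial one by
    at most [L * s * enorm d ^+ 2]. Without convexity the lower model has to come from the same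
    estimate as the upper one. *)
Lemma descent {R : realType} {n : nat} (L : R) (f : 'rV[R]_n -> R)
    (x d : 'rV[R]_n) :
  0 < L -> C11 L f ->
  `|f (d + x) - f x - dotv (gradient f x) d| <= L / 2 * enorm d ^+ 2.
Proof.
move=> L0 [df lipf].
have dphi s := @is_derive_line _ _ f x d s df.
have slope s : 0 < s < 1 ->
  enorm (gradient f (s *: d + x) - gradient f x) <= L * s * enorm d.
  move=> /andP[s0 _]; apply: le_trans (lipf _ _) _.
  by rewrite addrK enormZ gtr0_norm // mulrA.
have up : f (d + x) - f x <= dotv (gradient f x) d + L / 2 * enorm d ^+ 2.
  have := @increment_le_quadratic _ _ _ 0 1 (dotv (gradient f x) d)
    (L * enorm d ^+ 2) ler01 dphi.
  rewrite /= scale1r scale0r add0r subr0 expr1n !mulr1.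
  rewrite (mulrAC L) => -> // s s01; rewrite subr0.
  rewrite -lerBlDl -dotvNl -dotvDl mulrAC dotv_le ?slope //.
  by rewrite mulr_gt0 //; case/andP: s01.
(* The lower model of [f] is the upper model of [- f] on the same segment. *)
have dn (s : R) : is_derive s (1 : R) (- (fun s : R => f (s *: d + x)))
    (dotv (- gradient f (s *: d + x)) d).
  rewrite dotvNl; have := dphi s => ?; exact: is_deriveN.
have lo : f x - f (d + x) <= - dotv (gradient f x) d + L / 2 * enorm d ^+ 2.
  have := @increment_le_quadratic _ _ _ 0 1 (- dotv (gradient f x) d)
    (L * enorm d ^+ 2) ler01 dn.
  rewrite /= !fctE scale1r scale0r add0r subr0 expr1n !mulr1.
  rewrite (mulrAC L) opprK addrC => -> // s s01; rewrite subr0.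
  rewrite -lerBlDl opprK -dotvDl addrC mulrAC dotv_le //.
    by rewrite mulr_gt0 //; case/andP: s01.
  by rewrite -enormN opprB slope.
rewrite ler_norml; apply/andP; split; lra.
Qed.

(** Once the two models are compared at a common point, the inequality splits over coordinates. The
    slack in each is [(1 / L - s) * (u - v) ^+ 2], which is where the bound on the step length
    enters. *)
Lemma gradient_step_decrease {R : realType} {n : nat} (L s : R)
    (f : 'rV[R]_n -> R) (x y : 'rV[R]_n) :
  0 < L -> C11 L f -> 0 < s <= 1 / L -> y = x - s *: gradient f x ->
  (3 * s - L * s ^+ 2) * enorm (gradient f x) ^+ 2
    + s * enorm (gradient f y) ^+ 2 <= 4 * (f x - f y).
Proof.
move=> L0 Cf /andP[s0 sL] yE.
set a := gradient f x in yE *; set b := gradient f y.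
(* The point p + x = q + y maximises the gap between the quadratic lower bound
   of f at y and the quadratic upper bound of f at x. *)
pose p := - (s / 2) *: a + (2 * L)^-1 *: (b - a).
pose q := (s / 2) *: a + (2 * L)^-1 *: (b - a).
have pq : p + x = q + y.
  by apply/rowP => i; rewrite yE !mxE; field; rewrite gt_eqF.
have := @descent _ _ L f x p L0 Cf; rewrite ler_norml => /andP[_ up].
have := @descent _ _ L f y q L0 Cf; rewrite -pq ler_norml => /andP[lo _].
rewrite -/a in up; rewrite -/b in lo; clearbody a b.
suff : (3 * s - L * s ^+ 2) * enorm a ^+ 2 + s * enorm b ^+ 2 <=
  4 * (dotv b q - dotv a p - L / 2 * enorm p ^+ 2 - L / 2 * enorm q ^+ 2) by lra.
rewrite !sqr_enorm /dotv !mulr_sumr -!sumrB mulr_sumr -big_split /=.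
apply: ler_sum => i _; rewrite /p /q !mxE.
move: (a ord0 i) (b ord0 i) => u v.
rewrite -subr_ge0; set e := (X in 0 <= X).
have -> : e = (1 / L - s) * (u - v) ^+ 2 by rewrite /e; field; rewrite gt_eqF.
by rewrite mulr_ge0 ?sqr_ge0 // subr_ge0.
Qed.

(** A step of length [1 / L] along the negative gradient minimises the upper model at [x], and [f]
    is still at least [fstar] there. *)
Lemma sqr_enorm_gradient_le {R : realType} {n : nat} (L fstar : R)
    (f : 'rV[R]_n -> R) (x : 'rV[R]_n) :
  0 < L -> C11 L f -> (forall y, fstar <= f y) ->
  enorm (gradient f x) ^+ 2 <= 2 * L * (f x - fstar).
Proof.
move=> L0 Cf fge.
have := descent L f x (- L^-1 *: gradient f x) L0 Cf.
rewrite ler_norml => /andP[_].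
have dotE (g : 'rV[R]_n) : dotv g (- L^-1 *: g) = - L^-1 * enorm g ^+ 2.
  by rewrite sqr_enorm mulr_sumr; apply: eq_bigr => i _; rewrite mxE; ring.
rewrite dotE enormZ normrN gtr0_norm ?invr_gt0 //.
move: (fge (- L^-1 *: gradient f x + x)) (enorm _) => h e up.
rewrite -ler_pdivrMl ?mulr_gt0 //.
have -> : (2 * L)^-1 * e ^+ 2 = L^-1 * e ^+ 2 - L / 2 * (L^-1 * e) ^+ 2.
  by field; rewrite gt_eqF.
lra.
Qed.

(** * Upper bound on the objective *)

Lemma min_grad_norm_le {R : realType} {n N : nat} (f : 'rV[R]_n -> R)
    (x : nat -> 'rV[R]_n) (k : nat) :
  (1 <= k <= N.+1)%N -> min_grad_norm N f x <= enorm (gradient f (x k)).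
Proof.
move=> kN; apply: ge_bigmin_seq => //.
by rewrite mem_index_iota.
Qed.

Lemma min_grad_norm_ge0 {R : realType} {n N : nat} (f : 'rV[R]_n -> R)
    (x : nat -> 'rV[R]_n) :
  0 <= min_grad_norm N f x.
Proof.
rewrite /min_grad_norm; elim/big_ind: _ => [|u v u0 v0|k _]; try exact: enorm_ge0.
by rewrite le_min u0.
Qed.

Lemma min_grad_norm_upper {R : realType} {n N : nat} (L Delta fstar : R)
    (t : nat -> R) (f : 'rV[R]_n -> R) (x : nat -> 'rV[R]_n) :
  0 < L -> (forall k : nat, (1 <= k <= N)%N -> 0 < t k <= 1 / L) ->
  feasible N L Delta fstar t f x ->
  min_grad_norm N f x ^+ 2 *
    (\sum_(1 <= k < N.+1) (- L * t k ^+ 2 + 4 * t k) + 2 / L) <= 4 * Delta.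
Proof.
move=> L0 ht [fx1 xS fge Cf].
set v := min_grad_norm N f x.
have vle k : (1 <= k <= N.+1)%N -> v ^+ 2 <= enorm (gradient f (x k)) ^+ 2.
  by move=> kN; rewrite lerXn2r ?nnegrE ?enorm_ge0 ?min_grad_norm_ge0 ?min_grad_norm_le.
have step k : (1 <= k <= N)%N ->
    v ^+ 2 * (- L * t k ^+ 2 + 4 * t k) <= 4 * f (x k) - 4 * f (x k.+1).
  move=> kN; have /andP[k1 kN'] := kN.
  have /andP[tk0 tkL] := ht k kN.
  have := gradient_step_decrease L (t k) f (x k) (x k.+1) L0 Cf (ht k kN) (xS k kN).
  have := vle k; rewrite k1 leqW // => /(_ isT) hk.
  have := vle k.+1; rewrite /= ltnS kN' => /(_ isT) hk1.
  (* Both coefficients must be nonnegative for the squared gradient norms to be replaced by the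
     smaller [v ^+ 2]; their sum is [- L * t k ^+ 2 + 4 * t k]. *)
  have c0 : 0 <= 3 * t k - L * t k ^+ 2.
    have : L * t k <= 1 by rewrite mulrC -ler_pdivlMr.
    nra.
  have := ler_wpM2l c0 hk; have := ler_wpM2l (ltW tk0) hk1.
  lra.
have tele : \sum_(1 <= k < N.+1) (v ^+ 2 * (- L * t k ^+ 2 + 4 * t k)) <=
    4 * f (x 1%N) - 4 * f (x N.+1).
  rewrite -[leRHS]opprB -(telescope_sumr (fun k => 4 * f (x k))) // -sumrN.
  rewrite big_nat [leRHS]big_nat; apply: ler_sum => k kN.
  by rewrite opprB step.
(* The last iterate contributes the term [2 / L], as [4 / (2 * L)]. *)
have : v ^+ 2 <= 2 * L * (f (x N.+1) - fstar).
  apply: le_trans (vle N.+1 _) _; first by rewrite /= leqnn.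
  exact: sqr_enorm_gradient_le.
rewrite -ler_pdivrMl ?mulr_gt0 // => last.
rewrite mulrDr mulr_sumr.
have -> : v ^+ 2 * (2 / L) = 4 * ((2 * L)^-1 * v ^+ 2) by field; rewrite gt_eqF.
lra.
Qed.

(** * The one-dimensional worst-case function *)

Lemma antiderivative_left_zero {R : realType} (g : R -> R) (b : R) :
  continuous g -> (forall y, y <= b -> g y = 0) ->
  exists F : R -> R, (forall y, y <= b -> F y = 0) /\
    forall y : R, is_derive y (1 : R) F (g y).
Proof.
move=> cg g0.
(* Starting at [b - 1] rather than [b] makes every [y >= b] an interior point, as the fundamental
   theorem of calculus requires; for [y < b], [F] is locally zero. *)
pose F x := \int[lebesgue_measure]_(s in `[b - 1, x]%classic) g s.
have F0 y : y <= b -> F y = 0.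
  move=> yb; rewrite /F /Rintegral integral0_eq // => z.
  by rewrite /= in_itv /= => /andP[_ zy]; rewrite g0 // (le_trans zy).
exists F; split=> // y; have [yb|by_] := ltP y b.
  rewrite g0 ?(ltW yb) //; apply: (@near_eq_is_derive _ _ _ (cst 0)).
  near=> z; rewrite F0 //; near: z; exact: lt_le_nbhsl.
have [dF F'] : derivable F y 1 /\ F^`()%classic y = g y.
  apply: (@continuous_FTC1_closed _ g (b - 1) y (y + 1)).
  - by rewrite ltrDl.
  - apply: continuous_compact_integrable; first exact: segment_compact.
    exact: continuous_subspaceT.
  - by rewrite (lt_le_trans _ by_) // ltrBlDr ltrDl.
  - exact: cg.
by apply: DeriveDef; rewrite // -derive1E.
Unshelve. all: by end_near. Qed.

(** The default value [0] of the maximum cuts the tents off at zero, so an antiderivative is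
    nondecreasing. *)
Definition tents {R : realType} (N : nat) (L U : R) (X : nat -> R) (y : R) : R :=
  \big[Num.max/0]_(1 <= k < N.+2) (U - L * `|y - X k|).

Lemma tents_ge0 {R : realType} (N : nat) (L U : R) (X : nat -> R) (y : R) :
  0 <= tents N L U X y.
Proof. by rewrite /tents; elim/big_rec: _ => // k z _ z0; rewrite le_max z0 orbT. Qed.

Lemma tents_le {R : realType} (N : nat) (L U c : R) (X : nat -> R) (y : R) :
  0 <= c -> (forall k, (1 <= k <= N.+1)%N -> U - L * `|y - X k| <= c) ->
  tents N L U X y <= c.
Proof. by move=> c0 le_c; rewrite /tents big_nat; apply: bigmax_le. Qed.

Lemma tents_center {R : realType} (N k : nat) (L U : R) (X : nat -> R) :
  0 <= L -> 0 <= U -> (1 <= k <= N.+1)%N -> tents N L U X (X k) = U.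
Proof.
move=> L0 U0 kN; apply/eqP; rewrite eq_le tents_le //=; last first.
  by move=> j _; rewrite gerBl mulr_ge0.
apply: (@bigmax_sup_seq _ _ _ _ _ k) => //; first by rewrite mem_index_iota.
by rewrite subrr normr0 mulr0 subr0.
Qed.

Lemma tents_lipschitz {R : realType} (N : nat) (L U : R) (X : nat -> R) (y z : R) :
  0 <= L -> `|tents N L U X y - tents N L U X z| <= L * `|y - z|.
Proof.
move=> L0; have half a b : tents N L U X a <= tents N L U X b + L * `|a - b|.
  apply: tents_le => [|k kN]; first by rewrite addr_ge0 ?tents_ge0 ?mulr_ge0.
  have : U - L * `|b - X k| <= tents N L U X b.
    by apply: (@bigmax_sup_seq _ _ _ _ _ k) => //; rewrite mem_index_iota.
  have : L * `|b - X k| <= L * (`|a - b| + `|a - X k|).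
    by rewrite ler_wpM2l // [`|a - b|]distrC ler_distD.
  lra.
rewrite ler_distl; have := half y z; have := half z y; rewrite distrC => h1 h2.
by apply/andP; split; lra.
Qed.

Lemma lipschitz_continuous {R : realType} (g : R -> R) (L : R) :
  0 < L -> (forall y z, `|g y - g z| <= L * `|y - z|) -> continuous g.
Proof.
move=> L0 lipg y; apply/cvgrPdist_le => e e0; near=> z.
apply: le_trans (lipg _ _) _; rewrite -ler_pdivlMl //; near: z.
by apply: cvgr_dist_le; [exact: cvg_id | rewrite mulr_gt0 ?invr_gt0].
Unshelve. all: by end_near. Qed.

(* Between X k.+1 and X k the slope dips at rate L to its value at the midpoint,
   which gives the term in L / 4; left of X N.+1 it falls to 0 over the length
   U / L, which gives U ^+ 2 / (2 * L). *)
Lemma worst_case_profile {R : realType} (N : nat) (L U fstar : R) (X : nat -> R) :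
  0 < L -> 0 <= U ->
  (forall k, (1 <= k <= N)%N -> X k.+1 <= X k) ->
  (forall k, (1 <= k <= N)%N -> L * (X k - X k.+1) <= U) ->
  exists F : R -> R,
    [/\ forall y : R, is_derive y (1 : R) F (tents N L U X y),
        forall y, fstar <= F y
      & F (X 1%N) - fstar <=
        \sum_(1 <= k < N.+1) (U * (X k - X k.+1) - L / 4 * (X k - X k.+1) ^+ 2)
          + U ^+ 2 / (2 * L)].
Proof.
move=> L0 U0 Xdec Xclose.
have Xmono i j : (1 <= i)%N -> (i <= j <= N.+1)%N -> X j <= X i.
  move=> i1 /andP[ij jN]; elim: j ij jN => [|j IH]; first by rewrite leqn0 => /eqP->.
  rewrite leq_eqVlt => /predU1P[-> //|ij jN].
  apply: le_trans (Xdec j _) (IH ij (ltnW jN)).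
  by rewrite (leq_trans i1).
(* The left foot of the tent centred at [X N.+1]. *)
pose b := X N.+1 - U / L.
have bX : b <= X N.+1 by rewrite gerBl divr_ge0 // ltW.
(* Left of all centres, the tent of the nearest one, [X N.+1], dominates the others. *)
have left y : y <= X N.+1 -> tents N L U X y <= Num.max 0 (L * (y - b)).
  move=> yX; apply: tents_le => [|k kN]; first by rewrite le_max lexx.
  have Xk : X N.+1 <= X k by case/andP: kN => k1 kN; apply: Xmono => //; rewrite kN /=.
  rewrite le_max; apply/orP; right.
  have -> : L * (y - b) = U - L * (X N.+1 - y).
    by rewrite /b; field; rewrite gt_eqF.
  rewrite lerD2l lerN2 ler_pM2l // distrC.
  by apply: le_trans (ler_norm _); rewrite lerD2r.
have [F [F0 dF]] : exists F : R -> R, (forall y, y <= b -> F y = 0) /\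
    forall y : R, is_derive y (1 : R) F (tents N L U X y).
  apply: antiderivative_left_zero.
    by apply: (@lipschitz_continuous _ _ L) => // y z; rewrite tents_lipschitz // ltW.
  move=> y yb; apply/eqP; rewrite eq_le tents_ge0 andbT.
  apply: le_trans (left y (le_trans yb bX)) _.
  by rewrite ge_max lexx pmulr_rle0 // subr_le0.
have nF (s : R) : is_derive s (1 : R) (- F) (- tents N L U X s).
  by have := dF s => ?; exact: is_deriveN.
have Fge0 y : 0 <= F y.
  have [yb|/ltW by_] := leP y b; first by rewrite F0.
  have := increment_le_quadratic _ _ _ _ 0 0 by_ nF.
  rewrite !fctE /= (F0 b) // => h; suff : - F y - - 0 <= 0 by lra.
  apply: le_trans (h _) _; last by rewrite !mul0r addr0.
  by move=> s _; rewrite mul0r addr0 oppr_le0 tents_ge0.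
have F_last : F (X N.+1) <= U ^+ 2 / (2 * L).
  have := increment_le_quadratic F _ _ _ 0 L bX dF.
  rewrite (F0 b) // subr0 mul0r add0r => h; apply: le_trans (h _) _.
    move=> s /andP[bs sX]; apply: le_trans (left s (ltW sX)) _.
    by rewrite add0r ge_max lexx andbT mulr_ge0 ?subr_ge0 // ltW.
  by rewrite le_eqVlt; apply/orP; left; apply/eqP; rewrite /b; field; rewrite gt_eqF.
have F_step k : (1 <= k <= N)%N ->
    F (X k) - F (X k.+1) <=
    U * (X k - X k.+1) - L / 4 * (X k - X k.+1) ^+ 2.
  move=> kN; have [k1 kN'] := andP kN.
  have hk := Xdec k kN; have hU := Xclose k kN.
  set p := X k.+1 in hk hU *; set q := X k in hk hU *.
  pose m := (p + q) / 2.
  have pm : p <= m by rewrite /m; lra.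
  have mq : m <= q by rewrite /m; lra.
  (* No centre lies strictly between [p] and [q]: those of index at most [k] are to the right of [q]
     or at it, the others to the left of [p] or at it. *)
  have dist j y : (1 <= j <= N.+1)%N -> y - p <= `|y - X j| \/ q - y <= `|y - X j|.
    move=> /andP[j1 jN]; have [jk|kj] := leqP j k.
      right; rewrite distrC; apply: le_trans (ler_norm _); rewrite lerD2r.
      by apply: Xmono; rewrite ?jk ?leqW.
    left; apply: le_trans (ler_norm _); rewrite lerD2l lerN2.
    by apply: Xmono; rewrite ?kj.
  (* On each half the tent of the nearer endpoint dominates. By [hU] it is still nonnegative there,
     so the cut-off at zero does not interfere. *)
  have up1 s : p < s < m -> tents N L U X s <= U + - L * (s - p).
    move=> /andP[ps]; rewrite /m => sm; apply: tents_le => [|j jN]; first nra.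
    by have [d|d] := dist j s jN; have := ler_wpM2l (ltW L0) d; nra.
  have up2 s : m < s < q -> tents N L U X s <= (U - L * (q - m)) + L * (s - m).
    rewrite /m => /andP[ms sq]; apply: tents_le => [|j jN]; first nra.
    by have [d|d] := dist j s jN; have := ler_wpM2l (ltW L0) d; nra.
  have := increment_le_quadratic F _ _ _ _ _ pm dF up1.
  have := increment_le_quadratic F _ _ _ _ _ mq dF up2.
  have -> : q - m = (q - p) / 2 by rewrite /m; field.
  have -> : m - p = (q - p) / 2 by rewrite /m; field.
  lra.
exists (cst fstar + F); split => [y|y|].
- by have := dF y => ?; apply: is_derive_eq; rewrite add0r.
- by rewrite !fctE lerDl.
rewrite !fctE addrAC subrr add0r.
have -> : F (X 1%N) = \sum_(1 <= k < N.+1) (F (X k) - F (X k.+1)) + F (X N.+1).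
  rewrite -[X in X + _]opprK -sumrN.
  under eq_bigr do rewrite opprB.
  by rewrite (telescope_sumr (fun k => F (X k))) // opprB subrK.
apply: lerD => //; rewrite big_nat [leRHS]big_nat; apply: ler_sum => k kN.
exact: F_step.
Qed.

(** * Lifting to [n] dimensions and attainment *)

Lemma gradient_coord {R : realType} {n : nat} (F dF : R -> R) (i : 'I_n)
    (x : 'rV[R]_n) :
  (forall y : R, is_derive y (1 : R) F (dF y)) ->
  differentiable (fun y : 'rV[R]_n => F (y ord0 i)) x /\
  gradient (fun y : 'rV[R]_n => F (y ord0 i)) x =
    dF (x ord0 i) *: delta_mx ord0 i.
Proof.
move=> dFE; have Fi := dFE (x ord0 i).
have dF1 : differentiable F (x ord0 i) by apply/derivable1_diffP.
have dc := @differentiable_coord R 1 n x ord0 i.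
have df : differentiable (F \o (fun y : 'rV[R]_n => y ord0 i : R)) x.
  exact: differentiable_comp.
split=> //; apply/rowP => j; rewrite !mxE.
(* Only coordinate [i] enters the function, so the two difference quotients are literally the same;
   the scalar direction is 1 or 0. *)
have -> : 'D_(delta_mx ord0 j) (fun y : 'rV[R]_n => F (y ord0 i)) x =
    'D_((delta_mx ord0 j : 'rV[R]_n) ord0 i) F (x ord0 i).
  rewrite /derive; set u := fun h : R => _; set v := fun h : R => _.
  suff -> : u = v by [].
  by apply/funext => h; rewrite /u /v /= !mxE.
rewrite deriveE // -[(delta_mx _ _ : 'rV[R]_n) _ _]mulr1 linearZ /= -deriveE //.
by rewrite derive_val !mxE eqxx eq_sym mulrC.
Qed.

Lemma enorm_delta {R : realType} {n : nat} (i : 'I_n) :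
  enorm (delta_mx ord0 i : 'rV[R]_n) = 1.
Proof.
rewrite /enorm (bigD1 i) //= mxE !eqxx expr1n big1 ?addr0 ?sqrtr1 // => j ji.
by rewrite mxE (negPf ji) andbF expr0n.
Qed.

Lemma coord_le_enorm {R : realType} {n : nat} (x : 'rV[R]_n) (i : 'I_n) :
  `|x ord0 i| <= enorm x.
Proof.
rewrite -sqrtr_sqr ler_wsqrtr // (bigD1 i) //= lerDl sumr_ge0 // => j _.
exact: sqr_ge0.
Qed.

(** The equation on [U] says that the height bound of [worst_case_profile], for iterates spaced by
    [U * t k], is exactly the budget [Delta]. *)
Lemma min_grad_norm_attained {R : realType} (n N : nat) (L Delta fstar U : R)
    (t : nat -> R) :
  (1 <= n)%N -> 0 < L -> 0 <= U ->
  (forall k : nat, (1 <= k <= N)%N -> 0 < t k <= 1 / L) ->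
  U ^+ 2 * (\sum_(1 <= k < N.+1) (- L * t k ^+ 2 + 4 * t k) + 2 / L)
    = 4 * Delta ->
  objective_values n N L Delta fstar t U.
Proof.
move=> n1 L0 U0 ht UE; pose i0 := Ordinal n1.
(* With gradient [U] at each iterate, these are the positions of the run started at [0]; the sum is
   empty for [k = 1]. *)
pose X k := - (U * \sum_(1 <= j < k) t j).
have XS k : (1 <= k <= N)%N -> X k - X k.+1 = U * t k.
  by case/andP=> k1 _; rewrite /X big_nat_recr //=; ring.
have [|k kN|F [dF Fge FX]] := worst_case_profile N L U fstar X L0 U0.
- move=> k kN; rewrite -subr_ge0 XS // mulr_ge0 //.
  by case/andP: (ht k kN) => /ltW.
- have /andP[_] := ht k kN; rewrite XS // ler_pdivlMr // => tL.
  by rewrite mulrCA [L * _]mulrC ler_piMr.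
pose f (y : 'rV[R]_n) := F (y ord0 i0).
pose x k : 'rV[R]_n := X k *: delta_mx ord0 i0.
have gE y : gradient f y = tents N L U X (y ord0 i0) *: delta_mx ord0 i0.
  exact: (gradient_coord F _ i0 y dF).2.
have gx k : (1 <= k <= N.+1)%N -> gradient f (x k) = U *: delta_mx ord0 i0.
  move=> kN; rewrite gE /x !mxE !eqxx mulr1.
  by rewrite tents_center // ltW.
have nx k : (1 <= k <= N.+1)%N -> enorm (gradient f (x k)) = U.
  by move=> kN; rewrite gx // enormZ enorm_delta mulr1 ger0_norm.
exists f, x; split; last first.
  apply/eqP; rewrite eq_le; apply/andP; split.
    rewrite /min_grad_norm big_nat; apply: le_bigmin => [|k kN]; by rewrite nx.
  by rewrite -(nx 1%N) // min_grad_norm_le.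
split.
- rewrite /f /x !mxE !eqxx mulr1; apply: le_trans FX _.
  rewrite -(ler_pM2l (_ : 0 < 4)) // -UE !mulrDr mulr_sumr mulr_sumr.
  rewrite le_eqVlt; apply/orP; left; apply/eqP; congr (_ + _); last first.
    by field; rewrite gt_eqF.
  rewrite big_nat [RHS]big_nat; apply: eq_bigr => k kN.
  by rewrite XS //; field.
- move=> k kN; rewrite gx; last by case/andP: kN => -> /= /leqW.
  rewrite /x scalerA -scalerBl; congr (_ *: _).
  by rewrite mulrC -(XS k kN) opprB addrC subrK.
- by move=> y; exact: Fge.
split=> [y|y z]; first exact: (gradient_coord F _ i0 y dF).1.
rewrite !gE -scalerBl enormZ enorm_delta mulr1.
apply: le_trans (tents_lipschitz _ _ _ _ _ _ (ltW L0)) _.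
rewrite ler_pM2l //; apply: le_trans (coord_le_enorm (y - z) i0).
by rewrite !mxE.
Qed.

Theorem proposition4 (R : realType) (n N : nat) (L Delta fstar : R)
    (t : nat -> R) (hn : (1 <= n)%N) (hN : (1 <= N)%N)
    (hL : 0 < L) (hDelta : 0 <= Delta)
    (ht : forall k : nat, (1 <= k <= N)%N -> 0 < t k <= 1 / L) :
  is_maximum (objective_values n N L Delta fstar t)
    (Num.sqrt
       (4 * Delta /
          (\sum_(1 <= k < N.+1)
              Num.min (- L ^+ 2 * t k ^+ 3 + 4 * t k)
                      (- L * t k ^+ 2 + 4 * t k)
           + 2 / L))).
Proof.
have tL k : (1 <= k <= N)%N -> 0 < t k /\ L * t k <= 1.
  by move=> kN; have /andP[-> h] := ht k kN; rewrite mulrC -ler_pdivlMr.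
have -> : \sum_(1 <= k < N.+1) Num.min (- L ^+ 2 * t k ^+ 3 + 4 * t k)
    (- L * t k ^+ 2 + 4 * t k) = \sum_(1 <= k < N.+1) (- L * t k ^+ 2 + 4 * t k).
  rewrite big_nat [RHS]big_nat; apply: eq_bigr => k /tL[tk Ltk].
  apply/min_idPr; rewrite lerD2r !mulNr lerN2.
  have -> : L ^+ 2 * t k ^+ 3 = L * t k ^+ 2 * (L * t k) by ring.
  by rewrite ler_piMr // mulr_ge0 ?sqr_ge0 // ltW.
set D := _ + 2 / L.
(* Each summand is [t k * (4 - L * t k)], at least [3 * t k]. Positivity of [D] is what allows the
   division in both halves below. *)
have D0 : 0 < D.
  rewrite ltr_wpDl ?divr_gt0 // big_nat sumr_ge0 // => k /tL[tk Ltk]; nra.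
split.
  apply: min_grad_norm_attained => //.
  rewrite sqr_sqrtr ?divr_ge0 ?mulr_ge0 ?(ltW D0) //.
  by rewrite divfK // gt_eqF.
move=> _ [f [x [fx ->]]].
rewrite -[leLHS]ger0_norm ?min_grad_norm_ge0 // -sqrtr_sqr ler_wsqrtr //.
rewrite ler_pdivlMr //; exact: min_grad_norm_upper ht fx.
Qed.
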